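(* Let $P(s),C(s)$ be $n\times n$ real rational proper transfer function matrices with no poles in the closed right half-plane, such that the feedback system of $P$ and $C$ is well-posed. If $$\theta(P(j\omega))+\theta(C(j\omega))<\pi\quad\text{for all }\omega\in[-\infty,\infty],$$ then the feedback system is stable, i.e., $(I+C(s)P(s))^{-1}$ is proper with no poles in the closed right half-plane.
   Context: For a nonzero $A\in\mathbb{C}^{n\times n}$, the matrix singular angle $\theta(A)\in[0,\pi]$ is defined by $\cos\theta(A)=\inf\{\mathrm{Re}(x^*Ax)/(|x|\,|Ax|):0\ne x\in\mathbb{C}^n,\ Ax\ne0\}$; the frequency-wise singular angle is $\theta(P(j\omega))$ if $P(j\omega)\ne0$ and $0$ if $P(j\omega)=0$, where $P(j\pm\infty)=\lim_{\omega\to\pm\infty}P(j\omega)$. The feedback system of $P,C$ (with $u_1=e_1-y_2$, $u_2=e_2+y_1$, $y_1=Pu_1$, $y_2=Cu_2$) is well-posed if $(I+C(s)P(s))^{-1}$ exists and is proper, and (for such stable $P,C$) stable if and only if $(I+C(s)P(s))^{-1}$ is proper with no poles in the closed right half-plane. *)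

(* Defs.v *)
From HB Require Import structures.
From mathcomp Require Import all_boot all_order all_algebra.
From mathcomp Require Import all_classical all_reals all_analysis.
From mathcomp Require Import complex fraction.
From Stdlib Require Import ClassicalEpsilon.
Set Implicit Arguments. Unset Strict Implicit. Unset Printing Implicit Defensive.
Import Order.TTheory GRing.Theory Num.Theory.
Local Open Scope ring_scope.
Local Open Scope complex_scope.
Local Notation "x %:F" := (@tofrac _ x).
Import FracField.

Section Defs.
Variable R : realType.

Definition cconj (z : R[i]) : R[i] := Complex (complex.Re z) (- complex.Im z).
Definition cmod (z : R[i]) : R := Num.sqrt (complex.Re z ^+ 2 + complex.Im z ^+ 2).
Definition toC (x : R) : R[i] := Complex x 0.

Definition vnorm n (x : 'cV[R[i]]_n) : R :=
  Num.sqrt (\sum_(i < n) (complex.Re (x i ord0) ^+ 2 + complex.Im (x i ord0) ^+ 2)).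
Definition quadform n (A : 'M[R[i]]_n) (x : 'cV[R[i]]_n) : R[i] :=
  ((map_mx cconj x)^T *m A *m x) ord0 ord0.

Definition sangle_set n (A : 'M[R[i]]_n) : set R :=
  [set r | exists x : 'cV[R[i]]_n, [/\ x != 0, A *m x != 0 &
            r = complex.Re (quadform A x) / (vnorm x * vnorm (A *m x))]].
Definition sangle n (A : 'M[R[i]]_n) : R := acos (inf (sangle_set A)).

Definition fsangle n (A : 'M[R[i]]_n) : R := if A == 0 then 0 else sangle A.

Definition ratf := {fraction {poly R}}.
Definition cpoly (p : {poly R}) : {poly R[i]} := map_poly toC p.

Definition rhp_free (q : {poly R}) : Prop :=
  forall z : R[i], 0 <= complex.Re z -> (cpoly q).[z] != 0.

Definition proper_rf (f : ratf) : Prop :=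
  exists p q : {poly R}, [/\ q != 0, f = p%:F / q%:F & (size p <= size q)%N].
Definition rhp_stable_rf (f : ratf) : Prop :=
  exists p q : {poly R}, [/\ q != 0, f = p%:F / q%:F & rhp_free q].

Definition proper_mx n (G : 'M[ratf]_n) := forall i j, proper_rf (G i j).
Definition rhp_stable_mx n (G : 'M[ratf]_n) := forall i j, rhp_stable_rf (G i j).

(** value of a rational function at a complex point (where it is defined,
    independent of the representation) *)
Definition rf_val_at (f : ratf) (z : R[i]) (w : R[i]) : Prop :=
  exists p q : {poly R}, [/\ q != 0, f = p%:F / q%:F, (cpoly q).[z] != 0 &
                            w = (cpoly p).[z] / (cpoly q).[z]].
Definition rf_eval (f : ratf) (z : R[i]) : R[i] :=
  epsilon (inhabits 0) (rf_val_at f z).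
Definition mx_eval n (G : 'M[ratf]_n) (z : R[i]) : 'M[R[i]]_n :=
  \matrix_(i, j) rf_eval (G i j) z.

Definition cmx_lim_pinfty n (g : R -> 'M[R[i]]_n) (L : 'M[R[i]]_n) : Prop :=
  forall i j (e : R), 0 < e -> exists M : R, forall w, M < w -> cmod (g w i j - L i j) < e.
Definition cmx_lim_ninfty n (g : R -> 'M[R[i]]_n) (L : 'M[R[i]]_n) : Prop :=
  forall i j (e : R), 0 < e -> exists M : R, forall w, w < M -> cmod (g w i j - L i j) < e.

Definition freq_resp n (G : 'M[ratf]_n) (w : \bar R) : 'M[R[i]]_n :=
  match w with
  | EFin r => mx_eval G (Complex 0 r)
  | +oo%E => epsilon (inhabits 0) (cmx_lim_pinfty (fun r => mx_eval G (Complex 0 r)))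
  | -oo%E => epsilon (inhabits 0) (cmx_lim_ninfty (fun r => mx_eval G (Complex 0 r)))
  end.

Definition well_posed n (P C : 'M[ratf]_n) : Prop :=
  (1 + C *m P) \in unitmx /\ proper_mx (invmx (1 + C *m P)).
Definition fb_stable n (P C : 'M[ratf]_n) : Prop :=
  (1 + C *m P) \in unitmx /\ proper_mx (invmx (1 + C *m P))
  /\ rhp_stable_mx (invmx (1 + C *m P)).
End Defs.

(* Main.v *)
(** Write [P = Y / b] and [C = X / a] with common denominators [a], [b] free of
    zeros in the closed right half-plane, and let
    [N t := \det (a b I + t^2 X Y) = (a b)^n \det (I + t^2 C P)], so that the
    poles of [(I + C P)^-1] are among the zeros of [N 1].  The angle condition
    makes [I + t^2 C P] nonsingular at every [j w], including [w = +oo]; hence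
    [N t] has no zero on the imaginary axis and its degree does not depend on [t].
    For such a family, having no zero in the closed right half-plane is an open
    and closed condition on [t]: if [N u] satisfies it then
    [|N u (z)| >= c (1 + |z|)^d] for [Re z >= 0], which survives a small
    perturbation of the coefficients, and if [N u (z0) = 0] with [Re z0 > 0] then
    [N t] cannot satisfy it for [t] near [u], since that would give
    [|N t (z0)| >= |lead_coef (N t)| (Re z0)^d].  It holds at [t = 0]. *)

Require Import Defs.
From HB Require Import structures.
From mathcomp Require Import all_boot all_order all_algebra.
From mathcomp Require Import all_classical all_reals all_analysis.
From mathcomp Require Import perm complex fraction.
From mathcomp Require Import ring lra zify.
Import Order.TTheory GRing.Theory Num.Theory numFieldNormedType.Exports.
Local Open Scope ring_scope.

(** * Polynomials without zeros in the closed right half-plane *)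

Section ComplexPolynomials.
Variable R : realType.
Implicit Types (z w : R[i]) (p q : {poly R[i]}).

Lemma cmodE z : cmod z = Normc.normc z. Proof. by case: z. Qed.

Lemma cmodM z w : cmod (z * w) = cmod z * cmod w.
Proof. by rewrite !cmodE Normc.normcM. Qed.

Lemma cmod0 : cmod 0 = 0 :> R. Proof. by rewrite cmodE Normc.normc0. Qed.

Lemma cmod1 : cmod 1 = 1 :> R. Proof. by rewrite cmodE Normc.normc1. Qed.

Lemma cmodV z : cmod z^-1 = (cmod z)^-1.
Proof. by rewrite !cmodE Normc.normcV. Qed.

Lemma cmodX z k : cmod (z ^+ k) = cmod z ^+ k.
Proof. by elim: k => [|k IH]; rewrite ?cmod1 // !exprS cmodM IH. Qed.

Lemma cmodD z w : cmod (z + w) <= cmod z + cmod w.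
Proof. by rewrite !cmodE; apply: le_normcD. Qed.

Lemma cmodN z : cmod (- z) = cmod z.
Proof. by rewrite !cmodE; apply: normcN. Qed.

Lemma cmod_ge0 z : 0 <= cmod z. Proof. exact: sqrtr_ge0. Qed.

Lemma cmod_eq0 z : (cmod z == 0) = (z == 0).
Proof.
by apply/eqP/eqP => [|->]; [rewrite cmodE; apply: Normc.eq0_normc|exact: cmod0].
Qed.

Lemma cmod_real (x : R) : cmod x%:C%C = `|x|.
Proof. by rewrite /cmod /= expr0n addr0 sqrtr_sqr. Qed.

Lemma le_Re_cmod z : complex.Re z <= cmod z.
Proof.
rewrite (le_trans (ler_norm _)) // -sqrtr_sqr /cmod ler_sqrt ?lerDl ?sqr_ge0 //.
by rewrite addr_ge0 ?sqr_ge0.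
Qed.

Lemma ReB z w : complex.Re (z - w) = complex.Re z - complex.Re w.
Proof. by case: z; case: w. Qed.

Lemma cmod_sum (I : Type) (s : seq I) (F : I -> R[i]) :
  cmod (\sum_(i <- s) F i) <= \sum_(i <- s) cmod (F i).
Proof.
elim: s => [|i s IH]; first by rewrite !big_nil cmod0.
by rewrite !big_cons (le_trans (cmodD _ _)) // lerD2l.
Qed.

(** Stated over [R[i]], where polynomials split into linear factors; [rhp_free q] unfolds to this
    predicate at [cpoly q]. *)
Definition rhp_root_free p := forall z, 0 <= complex.Re z -> p.[z] != 0.

Lemma rhp_root_free_splits p : rhp_root_free p -> exists rs : seq R[i],
  [/\ p = lead_coef p *: \prod_(r <- rs) ('X - r%:P), size p = (size rs).+1,
      lead_coef p != 0 & all (fun r => complex.Re r < 0) rs].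
Proof.
move=> p_free.
have pn0 : p != 0 by apply/eqP => p0; have := p_free 0 (lexx _); rewrite p0 horner0 eqxx.
have lcn0 : lead_coef p != 0 by rewrite lead_coef_eq0.
have [rs def_p] := closed_field_poly_normal p; exists rs; split=> //.
  by rewrite def_p size_scale // size_prod_XsubC.
apply/allP => r r_rs; rewrite ltNge; apply: contraL isT => /p_free.
by rewrite def_p hornerZ (rootP _) ?mulr0 ?eqxx // root_prod_XsubC.
Qed.

Lemma cmod_subr_rhp_ge (r : R[i]) : complex.Re r < 0 ->
  exists2 c : R, 0 < c &
    forall z, 0 <= complex.Re z -> c * (1 + cmod z) <= cmod (z - r).
Proof.
set a := complex.Re r => a0.
have r0 := cmod_ge0 r.
(* Let m = |z - r|. Then m >= -a because Re z >= 0, and m >= |z| - |r|; multiplying these by 1 + |r|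
   and by -a and adding gives m (1 + |r| - a) >= -a (1 + |z|). *)
exists (- a / (1 + cmod r - a)); first by apply: divr_gt0; lra.
move=> z z0; rewrite mulrAC ler_pdivrMr; last by lra.
have := le_Re_cmod (z - r); rewrite ReB -/a => ma.
have := cmodD (z - r) r; rewrite subrK => zm.
nra.
Qed.

(** The bounds for the linear factors multiply. Growth of the full order is what absorbs a
    perturbation of the coefficients uniformly on the unbounded half-plane. *)
Lemma rhp_root_free_cmod_ge p : rhp_root_free p ->
  exists2 c : R, 0 < c & forall z, 0 <= complex.Re z ->
    c * (1 + cmod z) ^+ (size p).-1 <= cmod p.[z].
Proof.
case/rhp_root_free_splits => rs [def_p -> lcn0 rs_lhp] /=.
have lc0 : 0 < cmod (lead_coef p) by rewrite lt_neqAle eq_sym cmod_eq0 lcn0 cmod_ge0.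
suff [c c0 cP] : exists2 c : R, 0 < c & forall z, 0 <= complex.Re z ->
    c * (1 + cmod z) ^+ size rs <= cmod (\prod_(r <- rs) ('X - r%:P)).[z].
  exists (cmod (lead_coef p) * c); first exact: mulr_gt0.
  by move=> z z0; rewrite {2}def_p hornerZ cmodM -mulrA ler_pM2l // cP.
elim: rs rs_lhp {def_p} => [_|r rs IH /= /andP[r_lhp /IH[c c0 cP]]].
  by exists 1 => // z _; rewrite big_nil hornerC cmod1 expr0 mulr1.
have [b b0 bP] := cmod_subr_rhp_ge r r_lhp.
exists (b * c) => [|z z0]; first exact: mulr_gt0.
rewrite big_cons hornerM hornerXsubC cmodM exprS mulrACA.
have z1 : 0 <= 1 + cmod z by rewrite addr_ge0 ?cmod_ge0.
by apply: ler_pM; rewrite ?bP ?cP ?mulr_ge0 ?exprn_ge0 // ltW.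
Qed.

(** Each factor satisfies |z - r| >= Re z - Re r >= Re z. The roots enter only through their number,
    so along a family of fixed degree the bound varies only with the leading coefficient. *)
Lemma rhp_root_free_cmod_ge_Re p z : rhp_root_free p -> 0 <= complex.Re z ->
  cmod (lead_coef p) * complex.Re z ^+ (size p).-1 <= cmod p.[z].
Proof.
case/rhp_root_free_splits => rs [def_p -> lcn0 rs_lhp] z0 /=.
rewrite {2}def_p hornerZ cmodM ler_wpM2l ?cmod_ge0 //.
elim: rs rs_lhp {def_p} => [_|r rs IH /= /andP[r_lhp /IH rsP]].
  by rewrite big_nil hornerC cmod1.
rewrite big_cons hornerM hornerXsubC cmodM exprS ler_pM ?exprn_ge0 //.
by rewrite (le_trans _ (le_Re_cmod _)) // ReB; lra.
Qed.

Lemma cmod_horner_le p z k : (size p <= k.+1)%N ->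
  cmod p.[z] <= (\sum_(i < k.+1) cmod p`_i) * (1 + cmod z) ^+ k.
Proof.
move=> sz_p; rewrite (horner_coef_wide _ sz_p) (le_trans (cmod_sum _ _ _)) //.
rewrite mulr_suml; apply: ler_sum => i _.
rewrite cmodM cmodX ler_wpM2l ?cmod_ge0 //.
have z0 := cmod_ge0 z.
rewrite (@le_trans _ _ ((1 + cmod z) ^+ i)) //.
  by rewrite lerXn2r ?nnegrE ?addr_ge0 // lerDr.
by rewrite ler_weXn2l ?lerDl // -ltnS.
Qed.

End ComplexPolynomials.

(** * Invariance of the root condition along a polynomial family *)

Section Homotopy.
Variable R : realType.

Lemma cpolyE (p : {poly R}) : cpoly p = map_poly (real_complex R) p.
Proof. by []. Qed.

Lemma cpoly_horner_dist (p q : {poly R}) (k : nat) (z : R[i]) :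
  (size p <= k.+1)%N -> (size q <= k.+1)%N ->
  cmod ((cpoly p).[z] - (cpoly q).[z]) <=
    (\sum_(i < k.+1) `|p`_i - q`_i|) * (1 + cmod z) ^+ k.
Proof.
move=> sz_p sz_q; rewrite -hornerN -hornerD !cpolyE -rmorphB.
have sz_pq : (size (map_poly (real_complex R) (p - q)) <= k.+1)%N.
  by rewrite size_map_poly (leq_trans (size_polyD _ _)) // size_polyN geq_max sz_p.
apply: (le_trans (cmod_horner_le _ _ _ _ sz_pq)); apply: ler_wpM2r.
  by rewrite exprn_ge0 ?addr_ge0 ?cmod_ge0.
by apply: ler_sum => i _; rewrite coef_map cmod_real coefB.
Qed.

Variables (U : {poly {poly R}}) (d : nat).
(** The coefficients of [U] are themselves polynomials in the parameter t, so those of [N t] depend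
    continuously on t. *)
Let N t := map_poly (horner_eval t) U.
Hypothesis size_N : forall t, size (N t) = d.+1.
Hypothesis N_axis : forall t (w : R), (cpoly (N t)).[Complex 0 w] != 0.

Let dist (t u : R) : R := \sum_(i < d.+1) `|(N t)`_i - (N u)`_i|.

Lemma dist_small (u e : R) : 0 < e -> \forall t \near u, dist t u < e.
Proof.
move=> e0.
have : {for u, continuous (fun t => dist t u)}.
  apply: cvg_big => [|i _]; first exact: add_continuous.
  apply: cvg_norm; apply: cvgB; last exact: cvg_cst.
  rewrite /N; under eq_fun do rewrite coef_map.
  rewrite coef_map; exact: continuous_horner.
move=> /cvgr_lt; apply.
by rewrite /dist big1 // => i _; rewrite subrr normr0.
Qed.

(** A zero z of [N t] in the half-plane would give c (1 + |z|)^d <= |N u (z) - N t (z)| <= dist t u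
    (1 + |z|)^d, impossible once dist t u < c. *)
Lemma rhp_free_near (u : R) : rhp_free (N u) -> \forall t \near u, rhp_free (N t).
Proof.
move=> u_free; have [c c0 cP] := rhp_root_free_cmod_ge _ _ u_free.
near=> t => z z0; apply/eqP => Ntz.
have : dist t u < c by near: t; exact: dist_small.
have z1 : 0 < (1 + cmod z) ^+ d by rewrite exprn_gt0 // ltr_wpDr ?cmod_ge0.
rewrite -(ltr_pM2r z1) ltNge => /negP; apply.
have := cP _ z0; rewrite cpolyE size_map_poly size_N /= => /le_trans; apply.
apply: le_trans (cpoly_horner_dist _ _ _ z _ _); rewrite ?size_N //.
by rewrite Ntz sub0r cmodN.
Unshelve. all: by end_near. Qed.

Lemma not_rhp_free_near (u : R) :
  ~ rhp_free (N u) -> \forall t \near u, ~ rhp_free (N t).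
Proof.
move=> /existsNP[z] /not_implyP[z0] /negP; rewrite negbK => /eqP Nuz.
(* [N_axis] pushes the zero into the open half-plane, which makes a below positive. *)
have {}z0 : 0 < complex.Re z.
  rewrite lt_neqAle z0 andbT eq_sym; apply/eqP => zre.
  have := N_axis u (complex.Im z); rewrite -zre; case: (z) Nuz => a b /= ->.
  by rewrite eqxx.
set K := (1 + cmod z) ^+ d; set a := complex.Re z ^+ d.
have a0 : 0 < a by rewrite exprn_gt0.
have K0 : 0 < K by rewrite exprn_gt0 // ltr_wpDr ?cmod_ge0.
have lc_u : 0 < `|(N u)`_d|.
  by rewrite normr_gt0 -[d]/(d.+1.-1) -(size_N u) -lead_coefE lead_coef_eq0
             -size_poly_eq0 size_N.
near=> t => t_free.
(* If [N t] had no such zero, then (|lc (N u)| - dist t u) a <= |lc (N t)| a <= |N t (z)| <= dist t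
   u K; this threshold excludes that. *)
have : dist t u < `|(N u)`_d| * a / (K + a).
  near: t; apply: dist_small; by rewrite divr_gt0 ?mulr_gt0 ?addr_gt0.
rewrite ltr_pdivlMr ?addr_gt0 // ltNge => /negP; apply.
have := rhp_root_free_cmod_ge_Re _ _ z t_free (ltW z0).
rewrite lead_coefE cpolyE size_map_poly size_N coef_map /= cmod_real -/a => h1.
have := cpoly_horner_dist (N t) (N u) d z; rewrite !size_N Nuz subr0 -/K -/(dist t u).
move=> /(_ (ltnSn d) (ltnSn d)) h2.
have h3 : `|(N u)`_d| - dist t u <= `|(N t)`_d|.
  rewrite lerBlDl -lerBlDr (le_trans (lerB_dist _ _)) // distrC /dist.
  by rewrite (bigD1 ord_max) //= lerDl sumr_ge0.
rewrite -cpolyE in h1; nra.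
Unshelve. all: by end_near. Qed.

(** Connectedness of the line by way of calculus: the indicator of the condition is locally constant
    by the two preceding lemmas, so its derivative vanishes everywhere and it is constant. *)
Lemma rhp_free_homotopy (t u : R) : rhp_free (N t) -> rhp_free (N u).
Proof.
pose f s : R := (`[< rhp_free (N s) >])%:R.
suff : f t = f u.
  rewrite /f => ftu /asboolP Nt; move: ftu; rewrite Nt.
  by case: asboolP => // _ /eqP; rewrite oner_eq0.
have cst_near (x : R) : \forall y \near x, f y = f x.
  have [xf|xf] := pselect (rhp_free (N x)).
    near=> y; rewrite /f !asboolT //; near: y; exact: rhp_free_near.
  near=> y; rewrite /f !asboolF //; near: y; exact: not_rhp_free_near.
apply: is_derive_0_is_cst => x.
apply: (@near_eq_is_derive _ _ _ (cst (f x)) f) => //.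
by apply: filterS (cst_near x) => y ->.
Unshelve. all: by end_near. Qed.

End Homotopy.

(** * Singular angles *)

Section SingularAngle.
Variables (R : realType) (n : nat).
Implicit Types (x y : 'cV[R[i]]_n) (A B : 'M[R[i]]_n).

(** The Euclidean inner product of C^n seen as R^(2n), that is, the real part of the Hermitian
    one. *)
Definition re_dot x y : R :=
  \sum_i (complex.Re (x i ord0) * complex.Re (y i ord0) +
          complex.Im (x i ord0) * complex.Im (y i ord0)).

Lemma re_dotC x y : re_dot x y = re_dot y x.
Proof. by apply: eq_bigr => i _; congr (_ + _); exact: mulrC. Qed.

Lemma re_dotZr x y (s : R) : re_dot x (s%:C%C *: y) = s * re_dot x y.
Proof.
rewrite /re_dot mulr_sumr; apply: eq_bigr => i _.
by rewrite mxE; case: (y i ord0) => a b /=; ring.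
Qed.

Lemma Re_quadform A x : complex.Re (quadform A x) = re_dot x (A *m x).
Proof.
rewrite /quadform -mulmxA mxE /re_dot raddf_sum; apply: eq_bigr => i _.
rewrite !mxE /cconj; case: (x i ord0) => a b /=.
by case: (\sum_j _) => c d /=; ring.
Qed.

Lemma sqr_vnorm x : vnorm x ^+ 2 = re_dot x x.
Proof.
rewrite sqr_sqrtr; last by apply: sumr_ge0 => i _; rewrite addr_ge0 ?sqr_ge0.
by apply: eq_bigr => i _; rewrite !expr2.
Qed.

Lemma vnorm_ge0 x : 0 <= vnorm x. Proof. exact: sqrtr_ge0. Qed.

Lemma vnorm_gt0 x : x != 0 -> 0 < vnorm x.
Proof.
move=> xn0; rewrite lt_neqAle vnorm_ge0 andbT eq_sym; apply: contraNneq xn0 => nx0.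
have /eqP := sqr_vnorm x; rewrite nx0 expr0n eq_sym /re_dot psumr_eq0; last first.
  by move=> i _; rewrite -!expr2 addr_ge0 ?sqr_ge0.
move=> /allP x0; apply/eqP/colP => i; rewrite mxE.
have := x0 i (mem_index_enum i); rewrite -!expr2 paddr_eq0 ?sqr_ge0 // !sqrf_eq0.
by case: (x i ord0) => a b /= /andP[/eqP-> /eqP->].
Qed.

Lemma vnormZ x (s : R) : vnorm (s%:C%C *: x) = `|s| * vnorm x.
Proof.
apply/eqP; rewrite -(@eqrXn2 _ 2) ?mulr_ge0 ?vnorm_ge0 //; apply/eqP.
by rewrite exprMn !sqr_vnorm re_dotZr re_dotC re_dotZr mulrA real_normK ?num_real.
Qed.

Lemma ler_re_dot x y : re_dot x y <= vnorm x * vnorm y.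
Proof.
have [->|xn0] := eqVneq x 0.
  rewrite /re_dot big1 ?mulr_ge0 ?vnorm_ge0 // => i _.
  by rewrite mxE /= !mul0r addr0.
have [->|yn0] := eqVneq y 0.
  rewrite /re_dot big1 ?mulr_ge0 ?vnorm_ge0 // => i _.
  by rewrite mxE /= !mulr0 addr0.
set a := vnorm x; set b := vnorm y.
have a0 : 0 < a by exact: vnorm_gt0.
have b0 : 0 < b by exact: vnorm_gt0.
(* Cauchy-Schwarz: this sum is |b x - a y|^2, which expands to 2 a b (a b - <x, y>). *)
have : 0 <= \sum_i ((b * complex.Re (x i ord0) - a * complex.Re (y i ord0)) ^+ 2 +
                    (b * complex.Im (x i ord0) - a * complex.Im (y i ord0)) ^+ 2).
  by apply: sumr_ge0 => i _; rewrite addr_ge0 ?sqr_ge0.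
rewrite (_ : \sum_i _ = b ^+ 2 * re_dot x x + a ^+ 2 * re_dot y y
                        - (2 * a * b) * re_dot x y); last first.
  rewrite /re_dot !mulr_sumr -sumrN -!big_split /=.
  by apply: eq_bigr => i _; ring.
rewrite -!sqr_vnorm -/a -/b => h.
have ab0 : 0 < 2 * a * b by rewrite !mulr_gt0.
rewrite -(ler_pM2l ab0); lra.
Qed.

Definition re_cos x y : R := re_dot x y / (vnorm x * vnorm y).

Lemma re_cosC x y : re_cos x y = re_cos y x.
Proof. by rewrite /re_cos re_dotC [vnorm x * _]mulrC. Qed.

Lemma re_cosNr x y (s : R) : s < 0 -> re_cos x (s%:C%C *: y) = - re_cos x y.
Proof.
move=> s0; rewrite /re_cos re_dotZr vnormZ ltr0_norm // mulrCA !mulNr invrN mulrN.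
by rewrite invfM mulrACA divff ?mul1r // lt_eqF.
Qed.

Lemma re_cos_itv x y : x != 0 -> y != 0 -> -1 <= re_cos x y <= 1.
Proof.
move=> xn0 yn0.
have xy0 : 0 < vnorm x * vnorm y by rewrite mulr_gt0 ?vnorm_gt0.
rewrite /re_cos ler_pdivlMr // ler_pdivrMr // mul1r ler_re_dot andbT mulN1r lerNl.
have := ler_re_dot x ((-1)%:C%C *: y).
by rewrite re_dotZr vnormZ normrN1 mul1r mulN1r.
Qed.

Lemma ler_acos (a b : R) : -1 <= a -> a <= b -> b <= 1 -> acos b <= acos a.
Proof.
move=> a1 ab b1.
have a_itv : -1 <= a <= 1 by rewrite a1 (le_trans ab).
have b_itv : -1 <= b <= 1 by rewrite b1 (le_trans a1).
rewrite leNgt; apply/negP => ba.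
have : cos (acos b) < cos (acos a).
  by rewrite ltr_cos // in_itv /= acos_ge0 ?acos_lepi.
by rewrite !acosK ?in_itv //= ltNge ab.
Qed.

(** The quotient at x is at least the infimum, and [acos] reverses order. Cauchy-Schwarz bounds all
    quotients below by -1, so the infimum stays in the domain of [acos]. *)
Lemma acos_re_cos_le A x : x != 0 -> A *m x != 0 ->
  acos (re_cos x (A *m x)) <= fsangle A.
Proof.
move=> xn0 Axn0.
have An0 : A != 0 by apply: contraNneq Axn0 => ->; rewrite mul0mx.
have lb : lbound (sangle_set A) (-1).
  by move=> _ [y [yn0 Ayn0 ->]]; rewrite Re_quadform; case/andP: (re_cos_itv y _ yn0 Ayn0).
have x_in : sangle_set A (re_cos x (A *m x)) by exists x; rewrite Re_quadform.
rewrite /fsangle (negPf An0) /sangle; apply: ler_acos.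
- by apply: lb_le_inf lb; exists (re_cos x (A *m x)).
- by apply: ge_inf => //; exists (-1).
- by case/andP: (re_cos_itv x _ xn0 Axn0).
Qed.

(* If [x + s B A x = 0] with [s > 0], then the angles from [x] to [A x] and from
   [A x] to [B A x] add up to [pi], since [B A x] points along [- x]. *)
Lemma det_add1_mulmx_neq0 A B (s : R) : 0 <= s ->
  fsangle A + fsangle B < pi -> \det (1%:M + s%:C%C *: (B *m A)) != 0.
Proof.
(* [det0P] yields a row vector in the kernel, hence the passage to the transpose. *)
move=> s0 AB; rewrite -det_tr; apply/det0P => -[v vn0 v_ker].
pose x := v^T.
have xn0 : x != 0 by rewrite trmx_eq0.
have {v_ker} : (1%:M + s%:C%C *: (B *m A)) *m x = 0.
  by apply: trmx_inj; rewrite trmx_mul trmxK v_ker trmx0.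
rewrite mulmxDl mul1mx -scalemxAl -mulmxA => x_ker.
have {}s0 : 0 < s.
  rewrite lt_neqAle s0 andbT eq_sym; apply: contraNneq xn0 => s_eq0.
  by rewrite -x_ker s_eq0 scale0r addr0.
have sn0 : s%:C%C != 0 :> R[i] by rewrite (inj_eq (@complexI R)) gt_eqF.
have BAx : B *m (A *m x) = (- s^-1)%:C%C *: x.
  move/eqP: x_ker; rewrite addrC addr_eq0 => /eqP sBAx.
  by rewrite -[LHS](scalerK sn0) sBAx rmorphN fmorphV scaleNr scalerN.
have BAxn0 : B *m (A *m x) != 0.
  by rewrite BAx scaler_eq0 negb_or xn0 andbT rmorphN oppr_eq0 fmorphV invr_eq0.
have Axn0 : A *m x != 0 by apply: contraNneq BAxn0 => ->; rewrite mulmx0.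
have := acos_re_cos_le _ _ xn0 Axn0; have := acos_re_cos_le _ _ Axn0 BAxn0.
rewrite BAx re_cosNr ?oppr_lt0 ?invr_gt0 // re_cosC acosN ?re_cos_itv //.
by move: AB; move: (fsangle A) (fsangle B) (acos _) => fA fB c; lra.
Qed.

End SingularAngle.

(** * Rational matrices and their frequency responses *)

Section TopCoefficient.
Variable A : comNzRingType.
Implicit Types p q : {poly A}.

Lemma size_mul_top p q k l : (size p <= k.+1)%N -> (size q <= l.+1)%N ->
  (size (p * q)%R <= (k + l).+1)%N.
Proof.
move=> sz_p sz_q; apply: (leq_trans (size_polyMleq _ _)).
by move: sz_p sz_q; move: (size p) (size q); lia.
Qed.

Lemma coef_mul_top p q k l : (size p <= k.+1)%N -> (size q <= l.+1)%N ->
  (p * q)`_(k + l) = p`_k * q`_l.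
Proof.
move=> sz_p sz_q; have kl : (k < (k + l).+1)%N by rewrite ltnS leq_addr.
rewrite coefM (bigD1 (Ordinal kl)) //= addKn big1 ?addr0 // => i ik.
have {}ik : (i : nat) != k by [].
case: (ltngtP i k) ik => // [ik|ki] _.
  by rewrite [q`_ _]nth_default ?mulr0 // (leq_trans sz_q) //; lia.
by rewrite nth_default ?mul0r // (leq_trans sz_p).
Qed.

Lemma prod_top (I : Type) (s : seq I) (F : I -> {poly A}) k :
  (forall i, size (F i) <= k.+1)%N ->
  (size (\prod_(i <- s) F i)%R <= (size s * k).+1)%N /\
  (\prod_(i <- s) F i)`_(size s * k) = \prod_(i <- s) (F i)`_k.
Proof.
move=> sz_F; elim: s => [|i s [sz_s coef_s]].
  by rewrite !big_nil mul0n size_poly1 coefC.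
by rewrite !big_cons /= mulSn coef_mul_top // coef_s size_mul_top.
Qed.

(** Each Leibniz term is a product of n entries. Since k only bounds the degrees, the top
    coefficient may vanish; excluding this is where the value at infinity enters. *)
Lemma det_top n (M : 'M[{poly A}]_n) k : (forall i j, size (M i j) <= k.+1)%N ->
  (size (\det M) <= (n * k).+1)%N /\ (\det M)`_(n * k) = \det (map_mx (coefp k) M).
Proof.
move=> sz_M.
have topP (s : 'S_n) := prod_top _ (index_enum 'I_n) (fun i => M i (s i)) k
  (fun i => sz_M i (s i)).
have size_n : size (index_enum 'I_n) = n.
  by rewrite -[RHS]card_ord cardT; congr size; rewrite enumT.
split.
  rewrite (leq_trans (size_sum _ _ _)) //; apply/bigmax_leqP => s _.
  by rewrite -signr_odd mulr_sign; case: (odd _); rewrite ?size_polyN;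
     case: (topP s) => + _; rewrite size_n.
rewrite /determinant coef_sum; apply: eq_bigr => s _.
have [_] := topP s; rewrite size_n => top_s.
transitivity ((-1) ^+ s * (\prod_i M i (s i))`_(n * k)).
  by case: (odd_perm s); rewrite ?expr0 ?expr1 ?mul1r ?mulN1r ?coefN.
by rewrite top_s; congr (_ * _); apply: eq_bigr => i _; rewrite mxE.
Qed.

Lemma mulmx_top n (X Y : 'M[{poly A}]_n) k l :
  (forall i j, size (X i j) <= k.+1)%N -> (forall i j, size (Y i j) <= l.+1)%N ->
  (forall i j, size ((X *m Y) i j) <= (k + l).+1)%N /\
  map_mx (coefp (k + l)) (X *m Y) = map_mx (coefp k) X *m map_mx (coefp l) Y.
Proof.
move=> sz_X sz_Y; split=> [i j|].
  rewrite mxE (leq_trans (size_sum _ _ _)) //; apply/bigmax_leqP => m _.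
  exact: size_mul_top.
apply/matrixP => i j; rewrite !mxE /= coef_sum; apply: eq_bigr => m _.
by rewrite !mxE /= coef_mul_top.
Qed.

End TopCoefficient.

(** Links the polynomial determinant to the det (I + s C P) controlled by the angles; it serves both
    for values at j w and for top coefficients. *)
Lemma det_scalar_add_mulmx (F : fieldType) n (a b s : F) (X Y : 'M[F]_n) :
  a != 0 -> b != 0 ->
  \det ((a * b)%:M + s *: (X *m Y)) =
  (a * b) ^+ n * \det (1%:M + s *: ((a^-1 *: X) *m (b^-1 *: Y))).
Proof.
move=> an0 bn0; rewrite -detZ; congr (\det _).
rewrite scalerDr scale_scalar_mx mulr1 -scalemxAl -scalemxAr !scalerA.
by congr (_ + _ *: _); field; rewrite an0 bn0.
Qed.

(** * Common denominators, and values at finite and infinite frequencies *)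

Section RationalMatrices.
Variable R : realType.
Local Notation "x %:F" := (@FracField.tofrac _ x).
Implicit Types p q d : {poly R}.

Lemma rhp_free_neq0 q : rhp_free q -> q != 0.
Proof.
by move=> /(_ 0 (lexx _)); apply: contraNneq => ->; rewrite cpolyE rmorph0 horner0.
Qed.

Lemma rhp_free1 : rhp_free (1 : {poly R}).
Proof. by move=> z _; rewrite cpolyE rmorph1 hornerC oner_eq0. Qed.

Lemma rhp_freeM p q : rhp_free p -> rhp_free q -> rhp_free (p * q).
Proof.
by move=> pf qf z z0; rewrite cpolyE rmorphM hornerM mulf_neq0 ?pf ?qf.
Qed.

Lemma rhp_freeX p k : rhp_free p -> rhp_free (p ^+ k).
Proof.
move=> pf; elim: k => [|k IH]; first exact: rhp_free1.
by rewrite exprS; apply: rhp_freeM.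
Qed.

Lemma eq_frac p1 q1 p2 q2 : q1 != 0 -> q2 != 0 ->
  p1%:F / q1%:F = p2%:F / q2%:F -> p1 * q2 = p2 * q1.
Proof.
move=> q1n0 q2n0 /eqP; rewrite eqr_div ?tofrac_eq0 // -!tofracM tofrac_eq.
by move/eqP.
Qed.

(** Properness and stability may be witnessed by different fractions; comparing sizes in p1 q2 = p2
    q1 transfers properness to the stable one. *)
Lemma proper_stable_frac (f : ratf R) : proper_rf f -> rhp_stable_rf f ->
  exists p q, [/\ f = p%:F / q%:F, (size p <= size q)%N & rhp_free q].
Proof.
move=> [p1 [q1 [q1n0 f1 sz1]]] [p2 [q2 [q2n0 f2 q2f]]]; exists p2, q2; split=> //.
have [->|p2n0] := eqVneq p2 0; first by rewrite size_poly0.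
have e := eq_frac _ _ _ _ q1n0 q2n0 (etrans (esym f1) f2).
have p1n0 : p1 != 0.
  by apply: contraNneq (mulf_neq0 p2n0 q1n0) => p10; rewrite -e p10 mul0r.
have := congr1 (fun p => size (p : {poly R})) e; rewrite !size_mul //.
move: sz1 p1n0 p2n0 q1n0 q2n0; rewrite -!size_poly_gt0.
by move: (size p1) (size p2) (size q1) (size q2); lia.
Qed.

Lemma common_denominator n (G : 'M[ratf R]_n) : proper_mx G -> rhp_stable_mx G ->
  exists d (N : 'M[{poly R}]_n), [/\ G = d%:F^-1 *: map_mx (@FracField.tofrac _) N,
    (forall i j, size (N i j) <= size d)%N & rhp_free d].
Proof.
move=> Gp Gs.
have /choice[pq pqP] : forall ij : 'I_n * 'I_n, exists pq : {poly R} * {poly R},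
    [/\ G ij.1 ij.2 = pq.1%:F / pq.2%:F, (size pq.1 <= size pq.2)%N & rhp_free pq.2].
  by case=> i j; have [p [q ?]] := proper_stable_frac _ (Gp i j) (Gs i j); exists (p, q).
have prod_free (P : pred ('I_n * 'I_n)) : rhp_free (\prod_(ij | P ij) (pq ij).2).
  apply: big_ind => [||ij _]; [exact: rhp_free1|exact: rhp_freeM|].
  by case: (pqP ij).
(* The denominator is the product of all entry denominators; each numerator is multiplied by the
   others, which keeps the degree inequality. *)
exists (\prod_ij (pq ij).2).
exists (\matrix_(i, j) ((pq (i, j)).1 * \prod_(ij | ij != (i, j)) (pq ij).2)).
split; last exact: prod_free.
  apply/matrixP => i j; rewrite !mxE (bigD1 (i, j)) //=.
  have [/= -> _ qf] := pqP (i, j).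
  have q0 := rhp_free_neq0 _ qf; have r0 := rhp_free_neq0 _ (prod_free (predC1 (i, j))).
  rewrite !tofracM [RHS]mulrC -mulf_div divff ?mulr1 // tofrac_eq0; exact: r0.
move=> i j; rewrite mxE.
have -> : \prod_ij (pq ij).2 = (pq (i, j)).2 * \prod_(ij | ij != (i, j)) (pq ij).2.
  by rewrite (bigD1 (i, j)).
have [/= _ sz qf] := pqP (i, j).
have q0 := rhp_free_neq0 _ qf; have r0 := rhp_free_neq0 _ (prod_free (predC1 (i, j))).
have [->|p0] := eqVneq (pq (i, j)).1 0; first by rewrite mul0r size_poly0.
by rewrite !size_mul //; move: sz; move: (size _) (size _) (size _); lia.
Qed.

(** [epsilon] returns the value of some admissible fraction; by cross-multiplication all of them
    agree at z. *)
Lemma rf_eval_frac p q (z : R[i]) : (cpoly q).[z] != 0 ->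
  rf_eval (p%:F / q%:F) z = (cpoly p).[z] / (cpoly q).[z].
Proof.
move=> qz.
have qn0 : q != 0 by apply: contraNneq qz => ->; rewrite cpolyE rmorph0 horner0.
have : rf_val_at (p%:F / q%:F) z (rf_eval (p%:F / q%:F) z).
  by apply: ClassicalEpsilon.epsilon_spec; exists ((cpoly p).[z] / (cpoly q).[z]), p, q.
case=> p' [q' [q'n0 e q'z ->]]; apply/eqP; rewrite eqr_div // !cpolyE -!hornerM -!rmorphM.
by rewrite (eq_frac _ _ _ _ q'n0 qn0 (esym e)).
Qed.

Variables (n : nat) (d : {poly R}) (N : 'M[{poly R}]_n).
Hypotheses (d_free : rhp_free d) (size_N : forall i j, (size (N i j) <= size d)%N).
Let G := d%:F^-1 *: map_mx (@FracField.tofrac _) N.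

Lemma freq_resp_fin (w : R) : freq_resp G w%:E =
  (cpoly d).[Complex 0 w]^-1 *: map_mx (fun p => (cpoly p).[Complex 0 w]) N.
Proof.
apply/matrixP => i j; rewrite !mxE mulrC rf_eval_frac; first by rewrite mulrC.
exact: d_free.
Qed.

Let k := (size d).-1.

(** With l the ratio of the degree-k coefficients, r = p - l d has degree below k, so p / d - l = r
    / d is O(1 / |z|). *)
Lemma freq_resp_cvg (i j : 'I_n) (e : R) : 0 < e -> exists M : R, forall w, M < w ->
  cmod (mx_eval G (Complex 0 w) i j - ((N i j)`_k / d`_k)%:C%C) < e.
Proof.
move=> e0; set p := N i j; set l := p`_k / d`_k.
have dn0 := rhp_free_neq0 _ d_free.
have size_d : size d = k.+1 by rewrite /k prednK // size_poly_gt0.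
have [c c0 cP] := rhp_root_free_cmod_ge _ _ d_free.
pose r := p - l *: d.
have r_top m : (k <= m)%N -> r`_m = 0.
  rewrite coefB coefZ leq_eqVlt => /predU1P[<-|km].
    by rewrite /l divfK ?subrr // -[d`_k]/(lead_coef d) lead_coef_eq0.
  by rewrite !nth_default ?mulr0 ?subr0 // ?size_d // (leq_trans (size_N i j)) ?size_d.
pose K := \sum_(m < k.+1) cmod (cpoly r)`_m.
have K0 : 0 <= K by apply: sumr_ge0 => m _; exact: cmod_ge0.
have rP z : cmod (cpoly r).[z] * (1 + cmod z) <= K * (1 + cmod z) ^+ k.
  have sz_r : (size (cpoly r) <= k)%N.
    by rewrite cpolyE size_map_poly; apply/leq_sizeP.
  have K_wide : K = \sum_(m < k) cmod (cpoly r)`_m.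
    by rewrite /K big_ord_recr /= [(cpoly r)`_k]nth_default // cmod0 addr0.
  (* For k = 0 the polynomial r is zero; otherwise its degree is at most k - 1, leaving a spare
     factor 1 + |z|. *)
  case: (k) sz_r K_wide => [|k'] sz_r ->.
    move: sz_r; rewrite leqn0 size_poly_eq0 => /eqP->.
    by rewrite horner0 cmod0 mul0r big_ord0 mul0r.
  rewrite exprSr mulrA ler_wpM2r ?addr_ge0 ?cmod_ge0 //.
  exact: cmod_horner_le.
(* Beyond this threshold K < c e w <= c e (1 + |z|), while |r / d| (1 + |z|) <= K / c. *)
exists (K / (c * e)) => w Mw.
set z := Complex 0 w.
have dz : (cpoly d).[z] != 0 by exact: d_free.
rewrite !mxE mulrC rf_eval_frac //.
have -> : (cpoly p).[z] / (cpoly d).[z] - l%:C%C = (cpoly r).[z] / (cpoly d).[z].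
  rewrite /r !cpolyE rmorphB /= map_polyZ hornerD hornerN hornerZ mulrBl mulfK //.
rewrite cmodM cmodV.
have dz0 : 0 < cmod (cpoly d).[z] by rewrite lt_neqAle eq_sym cmod_eq0 dz cmod_ge0.
rewrite ltr_pdivrMr //.
have := cP z (lexx _); rewrite cpolyE size_map_poly -/k -cpolyE => dzP.
have z1 : 0 < 1 + cmod z by rewrite ltr_wpDr ?cmod_ge0.
rewrite -(ltr_pM2r z1); apply: (le_lt_trans (rP z)).
have M0 : 0 <= K / (c * e) by rewrite divr_ge0 // mulr_ge0 // ltW.
have wz : w <= cmod z by rewrite /cmod /= expr0n add0r sqrtr_sqr ler_norm.
move: Mw; rewrite ltr_pdivrMr ?mulr_gt0 // => Mw.
apply: (@lt_le_trans _ _ (e * (c * (1 + cmod z)  ^+ k) * (1 + cmod z))); last first.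
  by rewrite ler_pM2r // ler_pM2l.
rewrite (_ : e * _ * _ = (1 + cmod z) * (c * e) * (1 + cmod z) ^+ k); last by ring.
rewrite ltr_pM2r ?exprn_gt0 // (lt_le_trans Mw) // ler_pM2r ?mulr_gt0 //.
by rewrite (le_trans wz) // lerDr.
Qed.

(** The limit chosen by [epsilon] is a genuine limit because one exists; uniqueness of limits then
    identifies it. *)
Lemma freq_resp_pinfty : freq_resp G +oo%E =
  (d`_k)%:C%C^-1 *: map_mx (real_complex R) (map_mx (coefp k) N).
Proof.
set L := RHS.
have L_lim : cmx_lim_pinfty (fun r => mx_eval G (Complex 0 r)) L.
  move=> i j e e0; have [M MP] := freq_resp_cvg i j _ e0.
  have -> : L i j = ((N i j)`_k / d`_k)%:C%C by rewrite !mxE rmorphM fmorphV mulrC.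
  by exists M.
have := ClassicalEpsilon.epsilon_spec (inhabits 0)
  (cmx_lim_pinfty (fun r => mx_eval G (Complex 0 r))) (ex_intro _ L L_lim).
rewrite -[ClassicalEpsilon.epsilon _ _]/(freq_resp G +oo%E).
set L' := freq_resp _ _ => L'_lim.
apply/matrixP => i j; apply/eqP; rewrite -subr_eq0 -cmod_eq0 eq_le cmod_ge0 andbT.
apply/ler_addgt0Pl => e e0; rewrite addr0.
have e2 : 0 < e / 2 by rewrite divr_gt0.
have [M MP] := L_lim i j _ e2; have [M' M'P] := L'_lim i j _ e2.
pose w := Num.max M M' + 1.
have Mw : M < w by rewrite /w ltr_pwDr // le_max lexx.
have M'w : M' < w by rewrite /w ltr_pwDr // le_max lexx orbT.
have := MP w Mw; have := M'P w M'w; set g := mx_eval _ _ _ _ => h1 h2.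
have := cmodD _ (g - L i j) (- (g - L' i j)); rewrite cmodN.
have -> : g - L i j - (g - L' i j) = L' i j - L i j by ring.
lra.
Qed.

End RationalMatrices.

(** * The return difference *)

Lemma map_horner_eval_polyC (R : comNzRingType) (p : {poly R}) (x : R) :
  map_poly (horner_eval x) (map_poly polyC p) = p.
Proof.
rewrite -map_poly_comp map_poly_id // => a _ /=.
by rewrite horner_evalE hornerC.
Qed.

Local Notation "x %:F" := (@FracField.tofrac _ x).
Section Nyquist.
Variables (R : realType) (n : nat).
Variables (a b : {poly R}) (X Y : 'M[{poly R}]_n).

(* The square in [t] lets the homotopy parameter range over the whole line. *)
Definition return_difference (t : R) : 'M[{poly R}]_n :=
  (a * b)%:M + (t ^+ 2)%:P *: (X *m Y).

(** The same family with t as the inner indeterminate: ['X^2] stands for t^2, and real coefficients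
    become constants in t. Its determinant is the [U] of the homotopy argument. *)
Definition return_difference_bivariate : 'M[{poly {poly R}}]_n :=
  (map_poly polyC (a * b))%:M + ('X^2)%:P *: map_mx (map_poly polyC) (X *m Y).

Lemma det_return_differenceE t : \det (return_difference t) =
  map_poly (horner_eval t) (\det return_difference_bivariate).
Proof.
rewrite -det_map_mx; congr (\det _).
rewrite map_mxD map_scalar_mx map_mxZ /= map_horner_eval_polyC map_polyC /=.
rewrite horner_evalE hornerXn -map_mx_comp; congr (_ + _ *: _).
by apply/matrixP => i j; rewrite [RHS]mxE /= map_horner_eval_polyC.
Qed.

Lemma rmorph_det_return_difference (F : fieldType) (f : {rmorphism {poly R} -> F}) t :
  f a != 0 -> f b != 0 ->
  f (\det (return_difference t)) = (f a * f b) ^+ n *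
    \det (1%:M + f (t ^+ 2)%:P *: (((f a)^-1 *: map_mx f X) *m ((f b)^-1 *: map_mx f Y))).
Proof.
move=> fa fb; rewrite -det_scalar_add_mulmx // -det_map_mx.
by rewrite map_mxD map_scalar_mx map_mxZ map_mxM rmorphM.
Qed.

Hypotheses (a_free : rhp_free a) (b_free : rhp_free b).
Hypothesis size_X : forall i j, (size (X i j) <= size a)%N.
Hypothesis size_Y : forall i j, (size (Y i j) <= size b)%N.
Let C := (@FracField.tofrac _ a)^-1 *: map_mx (@FracField.tofrac _) X.
Let P := (@FracField.tofrac _ b)^-1 *: map_mx (@FracField.tofrac _) Y.
Hypothesis angle : forall w : \bar R,
  fsangle (freq_resp P w) + fsangle (freq_resp C w) < pi.

Lemma det_return_difference_axis t (w : R) :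
  (cpoly (\det (return_difference t))).[Complex 0 w] != 0.
Proof.
set z := Complex 0 w.
pose ev : {rmorphism {poly R} -> R[i]} := horner_eval z \o map_poly (real_complex R).
have az : ev a != 0 by exact: a_free.
have bz : ev b != 0 by exact: b_free.
rewrite -[_.[z]]/(ev _) rmorph_det_return_difference //.
rewrite mulf_neq0 ?expf_neq0 ?mulf_neq0 //.
have -> : ev (t ^+ 2)%:P = (t ^+ 2)%:C%C by rewrite /= map_polyC horner_evalE hornerC.
apply: det_add1_mulmx_neq0; first exact: sqr_ge0.
by have := angle w%:E; rewrite !freq_resp_fin.
Qed.

(** The coefficient at the maximal possible degree is (a_k b_l)^n det (I + t^2 C(oo) P(oo)), nonzero
    by the angle condition at +oo. *)
Lemma size_det_return_difference t :
  size (\det (return_difference t)) = (n * ((size a).-1 + (size b).-1)).+1.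
Proof.
set k := (size a).-1; set l := (size b).-1.
have a0 := rhp_free_neq0 _ _ a_free; have b0 := rhp_free_neq0 _ _ b_free.
have size_a : size a = k.+1 by rewrite /k prednK // size_poly_gt0.
have size_b : size b = l.+1 by rewrite /l prednK // size_poly_gt0.
have sz_X i j : (size (X i j) <= k.+1)%N by rewrite -size_a.
have sz_Y i j : (size (Y i j) <= l.+1)%N by rewrite -size_b.
have [sz_XY top_XY] := mulmx_top _ _ X Y k l sz_X sz_Y.
have entry i j : return_difference t i j =
    (a * b) *+ (i == j) + (t ^+ 2)%:P * (X *m Y) i j.
  by rewrite [LHS]mxE [Z in Z + _]mxE [Z in _ + Z]mxE.
have sz_M i j : (size (return_difference t i j) <= (k + l).+1)%N.
  rewrite entry (leq_trans (size_polyD _ _)) // geq_max; apply/andP; split.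
    case: (i == j); last by rewrite mulr0n size_poly0.
    by rewrite mulr1n size_mul_top ?size_a ?size_b.
  by rewrite mul_polyC (leq_trans (size_scale_leq _ _)).
have [sz_det top_det] := det_top _ _ (return_difference t) (k + l) sz_M.
apply/eqP; rewrite eqn_leq sz_det ltnNge /=; apply/negP => /leq_sizeP/(_ _ (leqnn _)).
rewrite top_det.
have -> : map_mx (coefp (k + l)) (return_difference t) =
    (a`_k * b`_l)%:M + t ^+ 2 *: (map_mx (coefp k) X *m map_mx (coefp l) Y).
  rewrite -top_XY; apply/matrixP => i j.
  rewrite [LHS]mxE entry /= coefD coefCM coefMn coef_mul_top ?size_a ?size_b //.
  by rewrite [RHS]mxE [Z in _ = Z + _]mxE [Z in _ = _ + Z]mxE [Z in _ = _ + _ * Z]mxE.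
have ak : a`_k != 0 by rewrite -[a`_k]/(lead_coef a) lead_coef_eq0.
have bl : b`_l != 0 by rewrite -[b`_l]/(lead_coef b) lead_coef_eq0.
apply/eqP; rewrite det_scalar_add_mulmx // mulf_neq0 ?expf_neq0 ?mulf_neq0 //.
rewrite -(inj_eq (@complexI R)) rmorph0 -det_map_mx.
rewrite map_mxD map_scalar_mx map_mxZ map_mxM !map_mxZ !fmorphV rmorph1.
apply: det_add1_mulmx_neq0; first exact: sqr_ge0.
by have := angle +oo%E; rewrite !freq_resp_pinfty.
Qed.

Lemma rhp_free_det_return_difference : rhp_free (\det (return_difference 1)).
Proof.
rewrite det_return_differenceE.
apply: (@rhp_free_homotopy _ _ (n * ((size a).-1 + (size b).-1)) _ _ 0).
- by move=> t; rewrite -det_return_differenceE size_det_return_difference.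
- by move=> t w; rewrite -det_return_differenceE det_return_difference_axis.
(* At t = 0 the determinant is (a b)^n. *)
rewrite -det_return_differenceE /return_difference expr0n polyC0 scale0r addr0.
by rewrite det_scalar; apply: rhp_freeX; apply: rhp_freeM.
Qed.

(** By Cramer's rule the inverse is a b times the adjugate of M, divided by det M, where M = a b I +
    X Y; so det M serves as a denominator of every entry. *)
Lemma rhp_stable_invmx_return_difference : rhp_stable_mx (invmx (1 + C *m P)).
Proof.
pose D := @FracField.tofrac _ (a * b).
pose Delta := \det (return_difference 1).
have Delta_free : rhp_free Delta := rhp_free_det_return_difference.
have Delta0 := rhp_free_neq0 _ _ Delta_free.
have DeltaF0 : Delta%:F != 0 by rewrite tofrac_eq0.
have D0 : D != 0 by rewrite tofrac_eq0 mulf_neq0 // (rhp_free_neq0 R).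
have CP : 1 + C *m P = D^-1 *: map_mx (@FracField.tofrac _) (return_difference 1).
  rewrite /return_difference expr1n polyC1 scale1r map_mxD map_scalar_mx map_mxM /=.
  rewrite scalerDr scale_scalar_mx mulVf // idmxE; congr (_ + _).
  by rewrite -scalemxAl -scalemxAr scalerA /D tofracM invfM.
have inv : (1 + C *m P) *m
    ((D / Delta%:F) *: map_mx (@FracField.tofrac _) (\adj (return_difference 1))) = 1%:M.
  rewrite CP -scalemxAl -scalemxAr scalerA -map_mxM mul_mx_adj map_scalar_mx /=.
  by rewrite scale_scalar_mx (mulKf D0) (mulVf DeltaF0).
have [CP_unit _] := mulmx1_unit inv.
have -> : invmx (1 + C *m P) =
    (D / Delta%:F) *: map_mx (@FracField.tofrac _) (\adj (return_difference 1)).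
  by rewrite -[RHS](mulKmx CP_unit) inv mulmx1.
move=> i j; exists (a * b * \adj (return_difference 1) i j), Delta; split=> //.
by rewrite [LHS]mxE [X in _ * X]mxE mulrAC tofracM.
Qed.

End Nyquist.

Theorem theorem3 (R : realType) (n : nat) (P C : 'M[ratf R]_n) :
  proper_mx P -> rhp_stable_mx P ->
  proper_mx C -> rhp_stable_mx C ->
  well_posed P C ->
  (forall w : \bar R, fsangle (freq_resp P w) + fsangle (freq_resp C w) < pi) ->
  fb_stable P C.
Proof.
move=> P_proper P_stable C_proper C_stable [CP_unit CP_proper] angle.
(* Well-posedness supplies invertibility and properness; the location of the poles remains. *)
split=> //; split=> //.
have [b [Y [defP sz_Y b_free]]] := common_denominator _ _ _ P_proper P_stable.
have [a [X [defC sz_X a_free]]] := common_denominator _ _ _ C_proper C_stable.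
move: angle; rewrite defP defC => angle.
exact: (rhp_stable_invmx_return_difference _ _ _ _ _ _ a_free b_free sz_X sz_Y angle).
Qed.
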